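(* Let $G$ be a finite simple undirected graph on $n$ vertices. Then $\mathrm{rotdim}(G) = n-1$ if and only if $G$ is the complete graph $K_n$.
   Context: Let $G=(V,E)$ be a finite simple undirected graph with $V=\{1,\dots,n\}$. For a vertex weight $s: V \to \mathbb{R}_{\geq 0}$ and an edge length $l: E \to \mathbb{R}_{\geq 0}$, consider the optimization problem: maximize $\sum_{i \in V} s(i)\|\mathbf{v}(i)\|^2$ over all maps $\mathbf{v}: V \to \mathbb{R}^n$ subject to $\sum_{i \in V} s(i)\mathbf{v}(i) = 0$ and $\|\mathbf{v}(i)-\mathbf{v}(j)\| \leq l(ij)$ for all $ij \in E$. An optimal solution $\mathbf{v}$ is called an optimal embedding. Define $\mathrm{rotdim}_G(s,l) := \min\{\dim \mathrm{span}\{\mathbf{v}(i) : i \in V\} : \mathbf{v} \text{ an optimal embedding}\}$, and for connected $G$, $\mathrm{rotdim}(G) := \max\{\mathrm{rotdim}_G(s,l) : s: V \to \mathbb{Z}_{\geq 0},\ l: E \to \mathbb{Z}_{\geq 0}\}$ (the rotational dimension). If $G$ is disconnected, $\mathrm{rotdim}(G)$ is defined as the maximum of $\mathrm{rotdim}(C)$ over the connected components $C$ of $G$. *)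

(* Defs.v *)
From HB Require Import structures.
From mathcomp Require Import all_boot all_order all_algebra.
From mathcomp Require Import boolp reals.

Set Implicit Arguments.
Unset Strict Implicit.
Unset Printing Implicit Defensive.

Import Order.TTheory GRing.Theory Num.Theory.
Local Open Scope ring_scope.

Record sgraph := SGraph {
  vertex :> finType;
  adj : rel vertex;
  adj_sym : symmetric adj;
  adj_irrefl : irreflexive adj }.

Definition edge_set (G : sgraph) : {set {set G}} :=
  [set [set p.1; p.2] | p in [set p : G * G | adj p.1 p.2]].

Definition edge (G : sgraph) : finType := {f : {set G} | f \in edge_set G}.

Definition complete (G : sgraph) : Prop :=
  forall x y : G, x != y -> adj x y.

Definition gconnected (G : sgraph) : bool :=
  [forall x : G, forall y : G, connect (@adj G) x y].

Definition gcomponents (G : sgraph) : {set {set G}} :=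
  [set [set y | connect (@adj G) x y] | x in [set: G]].

Lemma induced_sym (G : sgraph) (C : {set G}) :
  symmetric (fun x y : {x : G | x \in C} => adj (val x) (val y)).
Proof. by move=> x y; exact: adj_sym. Qed.

Lemma induced_irrefl (G : sgraph) (C : {set G}) :
  irreflexive (fun x y : {x : G | x \in C} => adj (val x) (val y)).
Proof. by move=> x; exact: adj_irrefl. Qed.

Definition induced (G : sgraph) (C : {set G}) : sgraph :=
  SGraph (@induced_sym G C) (@induced_irrefl G C).

(* The norm that 'rV[R]_m carries in the library is the sup norm. *)
Definition enorm (R : realType) (m : nat) (u : 'rV[R]_m) : R :=
  Num.sqrt (\sum_k u 0 k ^+ 2).

Section Embedding.
Variables (R : realType) (G : sgraph) (s : G -> R) (l : edge G -> R).

Definition embedding := G -> 'rV[R]_#|G|.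

Definition objective (v : embedding) : R :=
  \sum_i s i * enorm (v i) ^+ 2.

Definition feasible (v : embedding) : Prop :=
  \sum_i s i *: v i = 0 /\
  forall (f : edge G) (i j : G),
    val f = [set i; j] -> enorm (v i - v j) <= l f.

Definition optimal (v : embedding) : Prop :=
  feasible v /\ forall w, feasible w -> objective w <= objective v.

Definition span_dim (v : embedding) : nat := \dim <<codom v>>%VS.

(* The minimum may be taken over d <= #|G| since span_dim v <= #|G|; the
   default #|G| is returned when there is no optimal embedding, which cannot
   happen for G connected and s, l nonnegative. *)
Definition rotdim_at : nat :=
  \big[Order.min/#|G|]_(d < #|G|.+1 | `[< exists v, optimal v /\ span_dim v = d >])
     (d : nat).

Lemma span_dim_le v : (span_dim v <= #|G|)%N.
Proof. by rewrite (leq_trans (dimvS (subvf _)))// dimvf /dim/= mul1n. Qed.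

Lemma rotdim_at_le v : optimal v -> (rotdim_at <= span_dim v)%N.
Proof.
move=> vo; have dlt : (span_dim v < #|G|.+1)%N by rewrite ltnS span_dim_le.
rewrite /rotdim_at -leEnat.
apply: (@bigmin_le_cond _ nat _ #|G| (Ordinal dlt)
  (fun d => `[< exists w, optimal w /\ span_dim w = d >]) (@nat_of_ord _)).
by apply/asboolP; exists v.
Qed.

Lemma rotdim_at_attained v :
  optimal v -> exists2 w, optimal w & span_dim w = rotdim_at.
Proof.
move=> vo; have : rotdim_at = #|G| \/
    exists2 w, optimal w & span_dim w = rotdim_at.
  rewrite /rotdim_at; apply: (big_ind (fun m : nat => m = #|G| \/
    exists2 w, optimal w & span_dim w = m)); first by left.
    by move=> a b ha hb; rewrite minEnat /minn; case: ltnP.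
  by move=> d /asboolP[w [wo wd]]; right; exists w.
case=> // rG; exists v => //; apply/eqP.
by rewrite eqn_leq rotdim_at_le// andbT rG span_dim_le.
Qed.

End Embedding.

(* Spans have dimension at most #|G|, so this is the maximum of rotdim_at
   over all nonnegative integer data. *)
Definition rotdim_conn (R : realType) (G : sgraph) : nat :=
  \max_(d < #|G|.+1 | `[< exists (s : G -> nat) (l : edge G -> nat),
      rotdim_at (fun i => (s i)%:R : R) (fun f => (l f)%:R : R) = d >]) d.

Lemma rotdim_conn_ge (R : realType) (G : sgraph)
    (s : G -> nat) (l : edge G -> nat) :
  (rotdim_at (fun i => (s i)%:R : R) (fun f => (l f)%:R : R)
     <= rotdim_conn R G)%N.
Proof.
set r := rotdim_at _ _; have rlt : (r < #|G|.+1)%N.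
  by rewrite ltnS -leEnat; exact: bigmin_le_id.
rewrite /rotdim_conn (bigop.bigmax_sup (Ordinal rlt))//.
by apply/asboolP; exists s, l.
Qed.

Lemma rotdim_conn_attained (R : realType) (G : sgraph) :
  exists (s : G -> nat) (l : edge G -> nat),
    rotdim_at (fun i => (s i)%:R : R) (fun f => (l f)%:R : R) = rotdim_conn R G.
Proof.
have : rotdim_conn R G = 0%N \/ exists (s : G -> nat) (l : edge G -> nat),
    rotdim_at (fun i => (s i)%:R : R) (fun f => (l f)%:R : R)
      = rotdim_conn R G.
  rewrite /rotdim_conn; apply: (big_ind (fun m => m = 0%N \/
    exists (s : G -> nat) (l : edge G -> nat),
      rotdim_at (fun i => (s i)%:R : R) (fun f => (l f)%:R : R) = m));
    first by left.
    by move=> a b ha hb; rewrite /maxn; case: ltnP.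
  by move=> d /asboolP; right.
case=> // r0; exists (fun=> 0%N), (fun=> 0%N); apply/eqP.
by rewrite eqn_leq rotdim_conn_ge r0.
Qed.

Definition rotdim (R : realType) (G : sgraph) : nat :=
  if gconnected G then rotdim_conn R G
  else \max_(C in gcomponents G) rotdim_conn R (induced C).

(* Main.v *)
Require Import Defs.
From HB Require Import structures.
From mathcomp Require Import all_boot all_order all_algebra.
From mathcomp Require Import ring lra.
From mathcomp Require Import boolp reals.
From mathcomp Require Import classical_sets topology normedtype derive.

Set Implicit Arguments.
Unset Strict Implicit.
Unset Printing Implicit Defensive.

Import Order.TTheory GRing.Theory Num.Theory.
Import numFieldNormedType.Exports.
Local Open Scope ring_scope.

(** Weighted by [s], the objective of a centred embedding is
    [(2 * sum s)^-1 * sum_(i, j) s i * s j * |v i - v j|^2], so only mutual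
    distances matter.  For connected [G] an optimum exists by compactness, and
    the centring equation is a linear dependency, whence [rotdim <= n - 1].
    If [a] and [b] are not adjacent, rotate [b] about the affine span of the
    other [n - 2] points until it lies opposite to [a]: edge lengths are kept,
    [|v a - v b|] does not decrease, and the points then span at most [n - 2]
    dimensions.  For [K_n] with unit weights and lengths, comparison with the
    regular simplex forces every optimal embedding to be equilateral, hence of
    dimension [n - 1].  A disconnected graph has only components with fewer
    than [n] vertices. *)

(** * Euclidean geometry of row vectors *)

Section DotProduct.
Variables (R : realType) (m : nat).
Implicit Types (u v w z : 'rV[R]_m) (a : R).

Definition dot u v : R := \sum_k u 0 k * v 0 k.

Lemma dotC u v : dot u v = dot v u.
Proof. by apply: eq_bigr => k _; rewrite mulrC. Qed.

Lemma dotDl u v w : dot (u + v) w = dot u w + dot v w.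
Proof. by rewrite -big_split; apply: eq_bigr => k _; rewrite mxE mulrDl. Qed.

Lemma dotZl a u v : dot (a *: u) v = a * dot u v.
Proof. by rewrite mulr_sumr; apply: eq_bigr => k _; rewrite mxE mulrA. Qed.

Lemma dotNl u v : dot (- u) v = - dot u v.
Proof. by rewrite -scaleN1r dotZl mulN1r. Qed.

Lemma dotDr u v w : dot u (v + w) = dot u v + dot u w.
Proof. by rewrite dotC dotDl !(dotC u). Qed.

Lemma dotZr a u v : dot u (a *: v) = a * dot u v.
Proof. by rewrite dotC dotZl dotC. Qed.

Lemma dotNr u v : dot u (- v) = - dot u v.
Proof. by rewrite dotC dotNl dotC. Qed.

Lemma dot0l u : dot 0 u = 0.
Proof. by rewrite -(scale0r u) dotZl mul0r. Qed.

Lemma dot0r u : dot u 0 = 0.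
Proof. by rewrite dotC dot0l. Qed.

Definition dotE := (dotDl, dotDr, dotNl, dotNr, dotZl, dotZr).

Lemma dot_suml (I : finType) (P : pred I) (F : I -> 'rV[R]_m) u :
  dot (\sum_(i | P i) F i) u = \sum_(i | P i) dot (F i) u.
Proof.
apply: (big_morph (fun x => dot x u)); last exact: dot0l.
by move=> x y; rewrite dotDl.
Qed.

Lemma dot_sumr (I : finType) (P : pred I) (F : I -> 'rV[R]_m) u :
  dot u (\sum_(i | P i) F i) = \sum_(i | P i) dot u (F i).
Proof. by rewrite dotC dot_suml; apply: eq_bigr => i _; rewrite dotC. Qed.

Lemma dot_ge0 u : 0 <= dot u u.
Proof. by apply: sumr_ge0 => k _; rewrite -expr2 sqr_ge0. Qed.

Lemma dot_eq0 u : (dot u u == 0) = (u == 0).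
Proof.
apply/idP/eqP => [|->]; last by rewrite dot0l.
rewrite psumr_eq0 => [/allP u0|k _]; last by rewrite -expr2 sqr_ge0.
apply/rowP => k; rewrite mxE; apply/eqP.
by have := u0 k (mem_index_enum _); rewrite mulf_eq0 orbb.
Qed.

Lemma enormE u : enorm u = Num.sqrt (dot u u).
Proof. by congr Num.sqrt; apply: eq_bigr => k _; rewrite expr2. Qed.

Lemma sqr_enorm u : enorm u ^+ 2 = dot u u.
Proof. by rewrite enormE sqr_sqrtr ?dot_ge0. Qed.

Lemma enorm_ge0 u : 0 <= enorm u.
Proof. by rewrite enormE sqrtr_ge0. Qed.

Lemma enorm_le u a : 0 <= a -> (enorm u <= a) = (dot u u <= a ^+ 2).
Proof.
by move=> a0; rewrite -sqr_enorm ler_sqr ?nnegrE ?enorm_ge0.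
Qed.

Lemma dot_distC u v : dot (u - v) (u - v) = dot (v - u) (v - u).
Proof. by rewrite -opprB dotNl dotNr opprK. Qed.

Lemma dot_pythagoras u v : dot u v = 0 ->
  dot (u + v) (u + v) = dot u u + dot v v.
Proof. by move=> uv; rewrite !dotE (dotC v) uv addr0 add0r. Qed.

Lemma dot_orth_span (t : seq 'rV[R]_m) p x :
  (forall z, z \in t -> dot z x = 0) -> p \in <<t>>%VS -> dot p x = 0.
Proof.
move=> tx pt; rewrite (@coord_span _ _ _ (in_tuple t) p pt).
rewrite dot_suml big1 // => i _.
by rewrite dotZl tx ?mulr0 // mem_nth ?ltn_ord.
Qed.

(** Orthogonal projection onto a span, by Gram-Schmidt along the list [t]. *)
Lemma orth_decomp (t : seq 'rV[R]_m) u :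
  exists p x, [/\ u = p + x, p \in <<t>>%VS &
    forall z, z \in <<t>>%VS -> dot z x = 0].
Proof.
suff [p [x [-> pt xt]]] : exists p x, [/\ u = p + x, p \in <<t>>%VS &
    forall z, z \in t -> dot z x = 0].
  by exists p, x; split => // z; apply: dot_orth_span.
elim: t u => [|y t IH] u.
  by exists 0, u; rewrite add0r mem0v; split.
have [p [x [-> pt xt]]] := IH u; have [q [z [yE qt zt]]] := IH y.
have sub : (<<t>> <= <<y :: t>>)%VS by rewrite span_cons addvSr.
have yt : y \in <<y :: t>>%VS by rewrite memv_span ?mem_head.
have zyt : z \in <<y :: t>>%VS.
  have -> : z = y - q by rewrite yE addrAC subrr add0r.
  by rewrite rpredB // (subvP sub).
(* [z] is the part of the new vector [y] orthogonal to [<<t>>]. If it vanishes, the span has not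
   grown; otherwise the component of [x] along [z] moves into the projection. *)
have [z0|z0] := eqVneq z 0.
  exists p, x; split=> // [|w]; first exact: (subvP sub).
  rewrite inE => /predU1P[->|/xt//].
  by rewrite yE z0 addr0 (dot_orth_span xt).
pose c := dot z x / dot z z.
have zz0 : dot z z != 0 by rewrite dot_eq0.
exists (p + c *: z), (x - c *: z); split.
- by rewrite addrACA subrr addr0.
- by rewrite rpredD ?rpredZ // (subvP sub).
- move=> w; rewrite inE => /predU1P[->|wt].
    rewrite yE !dotE (dot_orth_span xt qt) (dot_orth_span zt qt).
    by rewrite /c divfK // mulr0 subr0 add0r subrr.
  by rewrite !dotE xt // zt // mulr0 subrr.
Qed.

(* The witness is [c = - |y| / |x|]; the inequality is Cauchy-Schwarz. *)
Lemma opposite_vector x y : x != 0 ->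
  exists2 c : R, dot (c *: x) (c *: x) = dot y y &
    dot (x - y) (x - y) <= dot (x - c *: x) (x - c *: x).
Proof.
rewrite -dot_eq0 => x0; have xgt0 : 0 < dot x x by rewrite lt0r x0 dot_ge0.
have [c c0 c2] : exists2 c : R, 0 <= c & c ^+ 2 * dot x x = dot y y.
  exists (Num.sqrt (dot y y / dot x x)); first exact: sqrtr_ge0.
  by rewrite sqr_sqrtr ?divr_ge0 ?dot_ge0 // divfK.
have cs : - dot x y <= c * dot x x.
  have := dot_ge0 (y + c *: x); rewrite !dotE (dotC y x) => h.
  have [cE|cN] := eqVneq c 0.
    move: c2; rewrite cE expr0n /= mul0r => /esym/eqP; rewrite dot_eq0 => /eqP->.
    by rewrite dot0r oppr0.
  have cgt0 : 0 < c by rewrite lt0r cN.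
  rewrite -(ler_pM2l cgt0); move: h; rewrite -c2; lra.
exists (- c); rewrite !dotE ?mulrA ?mulrNN -?expr2 //.
by rewrite (dotC y x); move: cs c2; lra.
Qed.

End DotProduct.

(** * Lagrange's identity and recentring *)

Section Lagrange.
Variables (R : realType) (m : nat) (I : finType) (s : I -> R).
Implicit Type v : I -> 'rV[R]_m.

Definition spread v : R :=
  \sum_i \sum_j s i * s j * dot (v i - v j) (v i - v j).

(** Lagrange's identity. It serves twice: with nonnegative weights of a centred embedding, where the
    last term vanishes, and with the signed coefficients of a linear dependency. *)
Lemma spreadE v :
  spread v = 2 * (\sum_i s i) * (\sum_i s i * dot (v i) (v i))
    - 2 * dot (\sum_i s i *: v i) (\sum_i s i *: v i).
Proof.
pose A i j := s j * (s i * dot (v i) (v i)).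
have -> : spread v = \sum_i \sum_j (A i j + A j i
    - 2 * dot (s i *: v i) (s j *: v j)).
  apply: eq_bigr => i _; apply: eq_bigr => j _.
  by rewrite /A !dotE (dotC (v j)); ring.
have AE : \sum_i \sum_j A j i = (\sum_i s i) * (\sum_i s i * dot (v i) (v i)).
  rewrite mulr_suml; apply: eq_bigr => i _; by rewrite mulr_sumr.
have AE' : \sum_i \sum_j A i j = \sum_i \sum_j A j i by rewrite exchange_big.
under eq_bigr do rewrite sumrB big_split /=.
rewrite sumrB big_split /= AE' AE dot_suml.
have -> : \sum_i \sum_j 2 * dot (s i *: v i) (s j *: v j) =
   \sum_i 2 * dot (s i *: v i) (\sum_j s j *: v j).
  by apply: eq_bigr => i _; rewrite dot_sumr mulr_sumr.
by rewrite -mulr_sumr; ring.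
Qed.

(** Translation by the weighted barycentre, written through differences so that the result visibly
    lies in the span of the [v i - v j]. *)
Definition recenter v : I -> 'rV[R]_m :=
  fun i => (\sum_j s j)^-1 *: (\sum_j s j *: (v i - v j)).

Hypothesis s_neq0 : \sum_i s i != 0.

Lemma recenterE v i :
  recenter v i = v i - (\sum_j s j)^-1 *: (\sum_j s j *: v j).
Proof.
rewrite /recenter (eq_bigr (fun j => s j *: v i - s j *: v j)) => [|j _].
  by rewrite sumrB -scaler_suml scalerBr scalerA mulVf // scale1r.
exact: scalerBr.
Qed.

Lemma recenterB v i j : recenter v i - recenter v j = v i - v j.
Proof. by rewrite !recenterE opprB addrA subrK. Qed.

Lemma sum_recenter v : \sum_i s i *: recenter v i = 0.
Proof.
under eq_bigr do rewrite recenterE scalerBr.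
by rewrite sumrB -scaler_suml scalerA mulfV // scale1r subrr.
Qed.

End Lagrange.

(** * Modifying optimal embeddings and bounding their dimension *)

Section Embeddings.
Variables (R : realType) (G : sgraph) (s : G -> R) (l : edge G -> R).
Hypotheses (s_ge0 : forall i, 0 <= s i) (l_ge0 : forall f, 0 <= l f).
Implicit Type v : embedding R G.

Lemma objectiveE v : objective s v = \sum_i s i * dot (v i) (v i).
Proof. by apply: eq_bigr => i _; rewrite sqr_enorm. Qed.

Lemma spread_feasible v : feasible s l v ->
  spread s v = 2 * (\sum_i s i) * objective s v.
Proof. by case=> v0 _; rewrite spreadE v0 dot0l mulr0 subr0 objectiveE. Qed.

Lemma mem_edge_set (i j : G) : ([set i; j] \in edge_set G) = adj i j.
Proof.
apply/imsetP/idP => [[[x y]]|ij]; last by exists (i, j); rewrite ?inE.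
rewrite inE /= => xy e.
have yNx : y != x by apply: contraTneq xy => ->; rewrite adj_irrefl.
have xE : x \in [set i; j] by rewrite e set21.
have yE : y \in [set i; j] by rewrite e set22.
case/set2P: xE => xE; case/set2P: yE => yE; rewrite -?xE -?yE //.
- by rewrite yE xE eqxx in yNx.
- by rewrite adj_sym.
- by rewrite yE xE eqxx in yNx.
Qed.

Lemma span_dim_sub v (t : seq 'rV[R]_#|G|) :
  (forall i, v i \in <<t>>%VS) -> (span_dim v <= size t)%N.
Proof.
move=> vt; apply: leq_trans (dim_span t); apply/dimvS/span_subvP.
by move=> _ /codomP[i ->].
Qed.

(** Recentring keeps differences, so edges that do not grow give feasibility; by [spread_feasible],
    distances that do not shrink give an objective at least as large. *)
Lemma recenter_optimal v w : 0 < \sum_i s i -> optimal s l v ->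
  (forall (f : edge G) i j, val f = [set i; j] ->
     dot (w i - w j) (w i - w j) <= dot (v i - v j) (v i - v j)) ->
  (forall i j, dot (v i - v j) (v i - v j) <= dot (w i - w j) (w i - w j)) ->
  optimal s l (recenter s w).
Proof.
move=> S0 [vf vopt] wE wge; have SN0 : \sum_i s i != 0 by rewrite gt_eqF.
have wf : feasible s l (recenter s w).
  split=> [|f i j fij]; first exact: sum_recenter.
  rewrite recenterB // enorm_le //; apply: le_trans (wE _ _ _ fij) _.
  by rewrite -enorm_le // vf.2.
split=> // z /vopt/le_trans; apply.
have S2 : 0 < 2 * \sum_i s i by rewrite mulr_gt0.
rewrite -(ler_pM2l S2) -!spread_feasible //.
apply: ler_sum => i _; apply: ler_sum => j _; rewrite recenterB //.
by rewrite ler_wpM2l ?wge // mulr_ge0.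
Qed.

(** Zero weights make the objective constant. This case is apart because there is no barycentre. *)
Lemma optimal0 : (forall i, s i = 0) ->
  optimal s l (fun=> 0) /\ span_dim (fun=> 0 : 'rV[R]_#|G|) = 0%N.
Proof.
move=> s0; split; first split.
- split=> [|f i j _]; first by rewrite big1 // => i _; rewrite scaler0.
  by rewrite subr0 enorm_le // dot0l sqr_ge0.
- move=> w _; rewrite !objectiveE !big1 // => i _; by rewrite s0 mul0r.
apply/eqP; rewrite -leqn0; apply: (@span_dim_sub _ [::]) => i; exact: mem0v.
Qed.

(** At a vertex [c] of nonzero weight, the centring equation expresses [v c] through the other
    vectors. *)
Lemma span_dim_lt v : \sum_i s i != 0 -> feasible s l v ->
  (span_dim v <= #|G| - 1)%N.
Proof.
move=> S0 [v0 _].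
have [c c0] : exists c, s c != 0.
  apply/existsP; apply: contraNT S0; rewrite negb_exists => /forallP h.
  by rewrite big1 // => i _; apply/eqP; have := h i; rewrite negbK.
have sz : size [seq v i | i <- enum (predC1 c)] = (#|G| - 1)%N.
  by rewrite size_map -cardE cardC1 subn1.
rewrite -sz; apply: span_dim_sub.
have vt i : i != c -> v i \in <<[seq v i | i <- enum (predC1 c)]>>%VS.
  by move=> ic; rewrite memv_span // map_f // mem_enum inE.
move=> i; have [->|/vt//] := eqVneq i c.
move/eqP: v0; rewrite (bigD1 c) //= addr_eq0 => /eqP e.
have -> : v c = (s c)^-1 *: (- \sum_(i | i != c) s i *: v i).
  by rewrite -e scalerA mulVf // scale1r.
by rewrite rpredZ // rpredN rpred_sum // => j jc; rewrite rpredZ // vt.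
Qed.

Lemma optimal_small_span v (a b c : G) : 0 < \sum_i s i -> optimal s l v ->
  ~~ adj a b -> a != b -> c != a -> c != b ->
  exists2 w, optimal s l w & (span_dim w <= #|G| - 2)%N.
Proof.
move=> S0 vopt Nab aNb cNa cNb.
(* With [v c] as origin, the affine span of the [n - 2] points other than [a] and [b] is directed by
   these [n - 3] differences. One more generator [x] may be added within the bound [n - 2]. *)
pose t := [seq v i - v c | i <- enum (~: [set a; b; c])].
have t_sz : (1 + size t = #|G| - 2)%N.
  have abc : #|[set a; b; c]| = 3%N.
    by rewrite finset.setUC cardsU1 cards2 !inE aNb (negPf cNa) (negPf cNb).
  have := max_card (mem [set a; b; c]); rewrite abc => n3.
  by rewrite size_map -cardE cardsCs finset.setCK abc add1n -subSn.
have memt i : i != a -> i != b -> v i - v c \in <<t>>%VS.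
  move=> ia ib; have [->|ic] := eqVneq i c; first by rewrite subrr mem0v.
  apply/memv_span/(map_f (fun i => v i - v c)).
  by rewrite mem_enum !inE (negPf ia) (negPf ib).
have small w x : (forall i, w i - w c \in <<x :: t>>%VS) ->
    (span_dim (recenter s w) <= #|G| - 2)%N.
  move=> wt; rewrite -t_sz; apply: (@span_dim_sub _ (x :: t)) => i.
  rewrite rpredZ // rpred_sum // => j _; rewrite rpredZ //.
  by rewrite -(subrKA (w c)) -(opprB (w j)) rpredB.
have sub x z : z \in <<t>>%VS -> z \in <<x :: t>>%VS.
  by apply/subvP; rewrite span_cons addvSr.
have mhd x : x \in <<x :: t>>%VS by rewrite memv_span ?mem_head.
(* [x] and [y] are the normal components of [a] and [b] relative to that affine span. *)
have [p [x [paE pt xt]]] := orth_decomp t (v a - v c).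
have [q [y [qbE qt yt]]] := orth_decomp t (v b - v c).
(* If [a] already lies in the affine span, nothing moves and [y] is the extra generator. *)
have [x0|x0] := eqVneq x 0.
  exists (recenter s v); first exact: recenter_optimal vopt _ _.
  apply: (small _ y) => i; have [->|ia] := eqVneq i a.
    by rewrite paE x0 addr0 sub.
  have [->|ib] := eqVneq i b; last exact/sub/memt.
  by rewrite qbE rpredD // sub.
have [k kx ky] := opposite_vector y x0.
(* The rotated [b] keeps its foot [q]; its normal component becomes a multiple of [x] with the
   length of [y]. *)
pose w i := if i == b then v c + q + k *: x else v i.
have wN i : i != b -> w i = v i by rewrite /w => /negPf ->.
have wb : w b = v c + q + k *: x by rewrite /w eqxx.
have vbE : v b = v c + q + y by rewrite -addrA -qbE addrC subrK.
have vaE : v a = v c + p + x by rewrite -addrA -paE addrC subrK.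
(* By Pythagoras, the distance to a point of the affine span depends only on the foot and the length
   of the normal component. *)
have eqN i : i != a -> i != b ->
    dot (w b - w i) (w b - w i) = dot (v b - v i) (v b - v i).
  move=> ia ib; rewrite wb (wN i) // vbE.
  have split z : v c + q + z - v i = (q - (v i - v c)) + z.
    by apply/rowP => ?; rewrite !mxE; ring.
  have dt : q - (v i - v c) \in <<t>>%VS by rewrite rpredB // memt.
  move: dt; rewrite !split; set d := q - _ => dt.
  have dx : dot d (k *: x) = 0 by rewrite dotZr xt // mulr0.
  by rewrite (dot_pythagoras dx) (dot_pythagoras (yt _ dt)) kx.
exists (recenter s w); last first.
  apply: (small _ x) => i; rewrite (wN c) //.
  have [->|ib] := eqVneq i b.
    have -> : w b - v c = q + k *: x by rewrite wb addrC !addrA addNr add0r.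
    by rewrite rpredD ?rpredZ // sub.
  rewrite wN //; have [->|ia] := eqVneq i a; last exact/sub/memt.
  by rewrite paE rpredD // sub.
(* Only the distance between [a] and [b] can change, and this pair is not an edge. *)
apply: recenter_optimal vopt _ _ => // [f i j fij|i j].
  have {f fij} ij : adj i j by rewrite -mem_edge_set -fij (valP f).
  have [ib|ib] := eqVneq i b; have [jb|jb] := eqVneq j b.
  - by rewrite ib jb !subrr.
  - rewrite ib eqN //; apply: contraNneq Nab => <-.
    by rewrite -ib adj_sym.
  - rewrite (dot_distC (w i)) (dot_distC (v i)) jb eqN //.
    by apply: contraNneq Nab => <-; rewrite -jb.
  - by rewrite !wN.
(* The tangential part [p - q] is common to both sides; [opposite_vector] compares the normal
   parts. *)
have main : dot (v a - v b) (v a - v b) <= dot (w a - w b) (w a - w b).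
  rewrite (wN a) // wb vbE vaE.
  have split z : v c + p + x - (v c + q + z) = (p - q) + (x - z).
    by apply/rowP => ?; rewrite !mxE; ring.
  have dt : p - q \in <<t>>%VS by rewrite rpredB.
  move: dt; rewrite !split; set d := p - q => dt.
  have dy : dot d (x - y) = 0 by rewrite dotDr dotNr xt // yt // subr0.
  have dx : dot d (x - k *: x) = 0.
    by rewrite dotDr dotNr dotZr xt // mulr0 subr0.
  by rewrite (dot_pythagoras dx) (dot_pythagoras dy) lerD2l.
have [ib|ib] := eqVneq i b; have [jb|jb] := eqVneq j b.
- by rewrite ib jb !subrr.
- by rewrite ib; have [->|ja] := eqVneq j a; [rewrite dot_distC (dot_distC (w b))|rewrite eqN].
- by rewrite jb; have [->//|ia] := eqVneq i a; rewrite dot_distC (dot_distC (w i)) eqN.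
- by rewrite !wN.
Qed.

End Embeddings.

(** * Maxima on closed bounded sets *)

Section BoxMaximum.
Local Open Scope classical_set_scope.
Variables (R : realType) (I : finType).

Lemma closed_forall (T : topologicalType) (J : Type) (A : J -> set T) :
  (forall j, closed (A j)) -> closed [set x | forall j, A j x].
Proof.
move=> cA; rewrite (_ : [set x | _] = \bigcap_(j in setT) A j).
  exact: closed_bigI.
by apply/seteqP; split => [x xA j _|x xA j]; exact: xA.
Qed.

(** The product topology lets Tychonoff's theorem give compact boxes. *)
Definition points := prod_topology (fun _ : I => R : topologicalType).

Lemma continuous_coord i : continuous (fun x : points => x i : R).
Proof. exact: (@proj_continuous I (fun=> R : topologicalType) i). Qed.

Lemma continuous_mul (T : topologicalType) (f g : T -> R) :
  continuous f -> continuous g -> continuous (fun x => f x * g x).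
Proof. by move=> cf cg x; apply: cvgM; [exact: cf|exact: cg]. Qed.

Lemma continuous_sub (T : topologicalType) (f g : T -> R) :
  continuous f -> continuous g -> continuous (fun x => f x - g x).
Proof. by move=> cf cg x; apply: cvgB; [exact: cf|exact: cg]. Qed.

Lemma continuous_sum (T : topologicalType) (J : finType) (F : J -> T -> R) :
  (forall j, continuous (F j)) -> continuous (fun x => \sum_j F j x).
Proof.
move=> cF; apply: continuous_big => //; exact: add_continuous.
Qed.

Lemma closed_imply (T : topologicalType) (P : Prop) (A : set T) :
  closed A -> closed [set x | P -> A x].
Proof.
move=> cA; have [p|Np] := pselect P.
  by rewrite (_ : [set x | _] = A)//; apply/seteqP; split => x //=; apply.
rewrite (_ : [set x | _] = setT); first exact: closedT.
by apply/seteqP; split => // x _ /Np.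
Qed.

Lemma box_max (A : set points) (f : points -> R) (M : R) :
  A !=set0 -> closed A -> (forall x i, A x -> `|x i| <= M) -> continuous f ->
  exists2 x, A x & forall y, A y -> f y <= f x.
Proof.
move=> A0 cA AM cf.
have : compact A.
  apply: (subclosed_compact cA
    (@tychonoff I (fun=> R : topologicalType) (fun=> `[- M, M]) _)).
    by move=> i; exact: segment_compact.
  by move=> x Ax i /=; rewrite in_itv /= -ler_norml AM.
move=> /(@compact_EVT_max points R f A A0)[|x /set_mem Ax xmax].
  exact: continuous_subspaceT.
by exists x => // y Ay; apply/xmax/mem_set.
Qed.

End BoxMaximum.

(** * Existence of optimal embeddings of connected graphs *)

Section OptimumExists.
Variables (R : realType) (G : sgraph) (s : G -> R) (l : edge G -> R).
Hypotheses (s_ge0 : forall i, 0 <= s i) (l_ge0 : forall f, 0 <= l f).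
Hypothesis G_conn : gconnected G.
Hypothesis s_gt0 : 0 < \sum_i s i.
Implicit Type v : embedding R G.

(** A crude common bound for all edge lengths. *)
Let L := \sum_f l f.

Lemma norm_coord_le m (u : 'rV[R]_m) k : `|u 0 k| <= enorm u.
Proof.
rewrite enormE -sqrtr_sqr ler_sqrt ?dot_ge0 // /dot (bigD1 k) //= -expr2.
by rewrite lerDl sumr_ge0 // => j _; rewrite -expr2 sqr_ge0.
Qed.

Lemma feasible_adj v i j k : feasible s l v -> adj i j ->
  `|v i 0 k - v j 0 k| <= L.
Proof.
move=> [_ vl] ij; have eij : [set i; j] \in edge_set G by rewrite mem_edge_set.
have := vl (Sub [set i; j] eij) i j (SubK _ _).
have := norm_coord_le (v i - v j) k; rewrite !mxE => h1 h2.
apply: le_trans h1 _; apply: le_trans h2 _.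
by rewrite /L (bigD1 (Sub [set i; j] eij)) //= lerDl sumr_ge0.
Qed.

Lemma feasible_path v i p k : feasible s l v -> path (@adj G) i p ->
  `|v i 0 k - v (last i p) 0 k| <= (size p)%:R * L.
Proof.
move=> vf; elim: p i => [|j p IH] i /=; first by rewrite subrr normr0 mul0r.
case/andP=> ij /IH h; rewrite -(subrKA (v j 0 k)).
apply: le_trans (ler_normD _ _) _; rewrite -nat1r mulrDl mul1r.
by rewrite lerD // feasible_adj.
Qed.

(** Paths bound all differences [v i - v j], and by centring [v i] is their weighted mean over
    [j]. *)
Lemma feasible_bounded v i k : feasible s l v -> `|v i 0 k| <= #|G|%:R * L.
Proof.
move=> vf; have L0 : 0 <= L by exact: sumr_ge0.
have dist j : `|v i 0 k - v j 0 k| <= #|G|%:R * L.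
  have /connectP[p ip ->] := forallP (forallP G_conn i) j.
  (* A path without repeated vertices has fewer than [#|G|] edges. *)
  case/shortenP: ip => q iq uq _.
  apply: le_trans (feasible_path k vf iq) _; rewrite ler_wpM2r // ler_nat.
  apply: ltnW; have /card_uniqP := uq => /= <-; exact: max_card.
rewrite -(ler_pM2l s_gt0) -[X in X * `|_|](gtr0_norm s_gt0) -normrM.
have -> : (\sum_j s j) * v i 0 k = \sum_j s j * (v i 0 k - v j 0 k).
  have [/rowP/(_ k)] := vf; rewrite summxE mxE => v0 _.
  under [RHS]eq_bigr do rewrite mulrBr; rewrite sumrB -mulr_suml.
  rewrite (_ : \sum_j s j * v j 0 k = 0) ?subr0 // -[RHS]v0.
  by apply: eq_bigr => j _; rewrite mxE.
apply: le_trans (ler_norm_sum _ _ _) _; rewrite mulr_suml ler_sum // => j _.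
by rewrite normrM (ger0_norm (s_ge0 j)) ler_wpM2l.
Qed.

Definition embedding_of (x : points R (G * 'I_#|G|)%type) : embedding R G :=
  fun i => \row_k x (i, k).

(** After squaring the length bounds, which [l_ge0] permits, all constraints are polynomial
    equations or weak inequalities in the coordinates. *)
Lemma closed_feasible : closed [set x | feasible s l (embedding_of x)]%classic.
Proof.
pose A1 k := [set x : points R (G * 'I_#|G|)%type |
  \sum_i s i * x (i, k) = 0]%classic.
pose A2 (f : edge G) (i j : G) := [set x : points R (G * 'I_#|G|)%type |
  val f = [set i; j]%SET ->
  \sum_k (x (i, k) - x (j, k)) * (x (i, k) - x (j, k)) <= l f ^+ 2]%classic.
rewrite (_ : [set x | _]%classic = ([set x | forall k, A1 k x] `&`
    [set x | forall f, forall i, forall j, A2 f i j x])%classic); last first.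
  apply/seteqP; split => x /= [x1 x2]; split.
  - move=> k; have /rowP/(_ k) := x1; rewrite summxE mxE => x0.
    rewrite /A1 /= -[RHS]x0; apply: eq_bigr => i _; by rewrite !mxE.
  - move=> f i j fij; have := x2 f i j fij; rewrite enorm_le // /dot.
    by under eq_bigr do rewrite !mxE.
  - apply/rowP => k; rewrite summxE mxE -[RHS](x1 k).
    by apply: eq_bigr => i _; rewrite !mxE.
  - move=> f i j fij; have := x2 f i j fij; rewrite enorm_le // /dot.
    by under [X in _ -> X <= _]eq_bigr do rewrite !mxE.
have cc p := @continuous_coord R (G * 'I_#|G|)%type p.
apply: closedI; apply: closed_forall.
  move=> k; apply: (@preimage_closed _ _ (fun x : points R _ =>
    \sum_i s i * x (i, k)) [set 0]%classic).
    move=> x _; apply: continuous_sum => i.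
    by apply: continuous_mul; [exact: cst_continuous|exact: cc].
  exact: closed_eq.
move=> f; apply: closed_forall => i; apply: closed_forall => j.
apply: closed_imply; apply: (@preimage_closed _ _ (fun x : points R _ =>
    \sum_k (x (i, k) - x (j, k)) * (x (i, k) - x (j, k)))
    [set y | y <= l f ^+ 2]%classic).
  move=> x _; apply: continuous_sum => k.
  by apply: continuous_mul; apply: continuous_sub; exact: cc.
exact: closed_le.
Qed.

Lemma exists_optimal : exists v, optimal s l v.
Proof.
have [||x i||x xf xmax] := @box_max R _
  [set x | feasible s l (embedding_of x)]%classic
  (fun x => \sum_i s i * \sum_k x (i, k) * x (i, k)) (#|G|%:R * L).
- exists (fun=> 0); split=> [|f i j _].
    rewrite big1 // => i _; rewrite (_ : embedding_of _ _ = 0) ?scaler0 //.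
    by apply/rowP => k; rewrite !mxE.
  by rewrite enorm_le // subrr dot0l sqr_ge0.
- exact: closed_feasible.
- by case: i => i k /(feasible_bounded i k); rewrite mxE.
- apply: continuous_sum => i; apply: continuous_mul.
    exact: cst_continuous.
  apply: continuous_sum => k.
  by apply: continuous_mul; exact: continuous_coord.
have objE y : objective s (embedding_of y) =
    \sum_i s i * \sum_k y (i, k) * y (i, k).
  rewrite objectiveE; apply: eq_bigr => i _; congr (_ * _).
  by apply: eq_bigr => k _; rewrite !mxE.
exists (embedding_of x); split=> // w wf.
have wE : w = embedding_of (fun p => w p.1 0 p.2).
  by apply/funext => i; apply/rowP => k; rewrite mxE.
have := xmax (fun p => w p.1 0 p.2).
by rewrite -(objE x) -(objE (fun p => w p.1 0 p.2)) /= -wE; exact.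
Qed.

End OptimumExists.

(** * Upper bounds for given weights and lengths *)

Section RotdimBounds.
Variables (R : realType) (G : sgraph) (s : G -> R) (l : edge G -> R).
Hypotheses (s_ge0 : forall i, 0 <= s i) (l_ge0 : forall f, 0 <= l f).
Hypothesis G_conn : gconnected G.

Lemma sum_weights_gt0 : ~ (forall i, s i = 0) -> 0 < \sum_i s i.
Proof.
move=> sN0; rewrite lt0r sumr_ge0 // andbT; apply/eqP => /eqP.
rewrite psumr_eq0 // => /allP s0; apply: sN0 => i; apply/eqP.
exact: (s0 i (mem_index_enum _)).
Qed.

Lemma rotdim_at_lt : (rotdim_at s l <= #|G| - 1)%N.
Proof.
have [s0|/sum_weights_gt0 s_gt0] := pselect (forall i, s i = 0).
  have [opt0 dim0] := optimal0 l_ge0 s0.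
  by apply: leq_trans (rotdim_at_le opt0) _; rewrite dim0.
have [v vopt] := exists_optimal s_ge0 l_ge0 G_conn s_gt0.
apply: leq_trans (rotdim_at_le vopt) _.
by apply: span_dim_lt (vopt.1); rewrite gt_eqF.
Qed.

Lemma rotdim_at_not_complete : ~ complete G -> (rotdim_at s l <= #|G| - 2)%N.
Proof.
move=> Gnc; have [s0|/sum_weights_gt0 s_gt0] := pselect (forall i, s i = 0).
  have [opt0 dim0] := optimal0 l_ge0 s0.
  by apply: leq_trans (rotdim_at_le opt0) _; rewrite dim0.
have [v vopt] := exists_optimal s_ge0 l_ge0 G_conn s_gt0.
have [a [b [aNb Nab]]] : exists a b : G, a != b /\ ~~ adj a b.
  apply: contrapT => h; apply: Gnc => a b aNb.
  by apply: contrapT => /negP Nab; apply: h; exists a, b.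
(* The base point is the first vertex after [a] on a path to [b]; it differs from [b] because [a]
   and [b] are not adjacent. *)
have [c cNa cNb] : exists2 c, c != a & c != b.
  have /connectP[[|c p] /= ip lst] := forallP (forallP G_conn a) b.
    by rewrite lst eqxx in aNb.
  have /andP[ac _] := ip; exists c.
    by apply: contraTneq ac => ->; rewrite adj_irrefl.
  by apply: contraNneq Nab => <-.
have [w wopt wdim] := optimal_small_span s_ge0 l_ge0 s_gt0 vopt Nab aNb cNa cNb.
exact: leq_trans (rotdim_at_le wopt) wdim.
Qed.

End RotdimBounds.

(** * The complete graph with unit weights and lengths *)

Section Simplex.
Variables (R : realType) (G : sgraph).
Hypothesis G_gt0 : (0 < #|G|)%N.
Let s : G -> R := fun=> 1.
Let l : edge G -> R := fun=> 1.
Implicit Type v : embedding R G.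

Let sum_s : \sum_i s i = #|G|%:R.
Proof. by rewrite sumr_const. Qed.

Let sum_s_gt0 : 0 < \sum_i s i.
Proof. by rewrite sum_s ltr0n. Qed.

(** Standard basis vectors are at distance [sqrt 2]; the factor makes all distances 1. *)
Definition simplex : embedding R G :=
  fun i => Num.sqrt 2^-1 *: delta_mx 0 (enum_rank i).

Lemma dot_delta m (u : 'rV[R]_m) k : dot u (delta_mx 0 k) = u 0 k.
Proof.
rewrite /dot (bigD1 k) //= !mxE !eqxx mulr1 big1 ?addr0 // => j jk.
by rewrite !mxE (negPf jk) andbF mulr0.
Qed.

Lemma simplex_dist i j : i != j ->
  dot (simplex i - simplex j) (simplex i - simplex j) = 1.
Proof.
move=> ij; rewrite -scalerBr dotZl dotZr mulrA -expr2 sqr_sqrtr ?invr_ge0 //.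
rewrite dotDr dotNr !dot_delta !mxE !eqxx /= !(inj_eq enum_rank_inj).
by rewrite (eq_sym j) (negPf ij) ?eqxx /=; lra.
Qed.

Lemma simplex_feasible : feasible s l (recenter s simplex).
Proof.
have SN0 : \sum_i s i != 0 by rewrite gt_eqF.
split=> [|f i j fij]; first exact: sum_recenter.
rewrite recenterB // enorm_le // expr1n; have [->|ij] := eqVneq i j.
  by rewrite subrr dot0l.
by rewrite simplex_dist.
Qed.

Hypothesis G_complete : complete G.

(** All pairs are edges, so no distance in [v] exceeds that in the simplex. Optimality makes the
    spread of [v] at least that of the simplex, which forces equality term by term. *)
Lemma optimal_dist v : optimal s l v ->
  forall i j, i != j -> dot (v i - v j) (v i - v j) = 1.
Proof.
move=> [vf vopt]; have SN0 : \sum_i s i != 0 by rewrite gt_eqF.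
pose d (w : embedding R G) i j := dot (w i - w j) (w i - w j).
have dle i j : d v i j <= d simplex i j.
  rewrite /d; have [->|ij] := eqVneq i j; first by rewrite !subrr dot0l.
  have eij : [set i; j] \in edge_set G by rewrite mem_edge_set G_complete.
  have := vf.2 (Sub [set i; j] eij) i j (SubK _ _).
  by rewrite enorm_le ?ler01 // simplex_dist // expr1n.
have := vopt _ simplex_feasible.
have S2 : 0 < 2 * \sum_i s i by rewrite mulr_gt0.
rewrite -(ler_pM2l S2) -!(@spread_feasible _ _ s l) //; last first.
  exact: simplex_feasible.
have spE w : spread s w = \sum_i \sum_j d w i j.
  by apply: eq_bigr => i _; apply: eq_bigr => j _; rewrite !mul1r.
have -> : spread s (recenter s simplex) = \sum_i \sum_j d simplex i j.
  rewrite spE; apply: eq_bigr => i _; apply: eq_bigr => j _.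
  by rewrite /d recenterB.
rewrite spE => ge i j ij; rewrite -(simplex_dist ij).
have D0 x y : 0 <= d simplex x y - d v x y by rewrite subr_ge0.
have : \sum_x \sum_y (d simplex x y - d v x y) == 0.
  rewrite eq_le (sumr_ge0 _ (fun x _ => sumr_ge0 _ (fun y _ => D0 x y))) andbT.
  by under eq_bigr do rewrite sumrB; rewrite sumrB subr_le0.
rewrite psumr_eq0 => [/allP/(_ i (mem_index_enum _))|x _]; last exact: sumr_ge0.
rewrite psumr_eq0 // => /allP/(_ j (mem_index_enum _)).
by rewrite subr_eq0 => /eqP.
Qed.

(* A dependency with zero coefficient sum has zero spread, which for unit
   distances is minus the sum of the squared coefficients. *)
Lemma equilateral_independent v (c : G -> R) :
  (forall i j, i != j -> dot (v i - v j) (v i - v j) = 1) ->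
  \sum_i c i = 0 -> \sum_i c i *: v i = 0 -> forall i, c i = 0.
Proof.
move=> vd c0 cv0; have := spreadE c v; rewrite c0 cv0 dot0l !mulr0 mul0r subr0.
have -> : spread c v = - \sum_i c i ^+ 2.
  rewrite -sumrN; apply: eq_bigr => i _.
  rewrite (bigD1 i) //= subrr dot0l mulr0 add0r.
  rewrite (eq_bigr (fun j => c i * c j)) => [|j ji]; last first.
    by rewrite vd ?mulr1 // eq_sym.
  rewrite -mulr_sumr; move: c0; rewrite (bigD1 i) //= => /eqP.
  by rewrite addrC addr_eq0 => /eqP ->; rewrite mulrN expr2.
move/eqP; rewrite oppr_eq0 psumr_eq0 => [/allP h i|i _]; last exact: sqr_ge0.
by apply/eqP; have := h i (mem_index_enum _); rewrite sqrf_eq0.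
Qed.

(** Rank-nullity for the map [phi] from coefficients to linear combinations of the [v g]: only
    constant coefficient vectors can lie in its kernel. *)
Lemma optimal_span_dim v : optimal s l v -> (#|G| - 1 <= span_dim v)%N.
Proof.
move=> vopt; have vd := optimal_dist vopt.
have v0 : \sum_i v i = 0.
  by rewrite -[RHS](vopt.1.1); apply: eq_bigr => i _; rewrite scale1r.
pose V := \matrix_(i < #|G|) v (enum_val i).
pose phi : 'End('rV[R]_#|G|) := linfun (mulmxr V).
have phiE c : phi c = \sum_g c 0 (enum_rank g) *: v g.
  rewrite lfunE /= mulmx_sum_row (reindex enum_rank) /=; last first.
    exact/onW_bij/enum_rank_bij.
  by apply: eq_bigr => g _; rewrite rowK enum_rankK.
have ker_le : (lker phi <= <[const_mx 1]>)%VS.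
  apply/subvP => c; rewrite memv_ker phiE => /eqP c0.
  (* As the [v g] sum to zero, subtracting the mean [mu] from the coefficients leaves a dependency,
     now with coefficient sum zero as [equilateral_independent] requires. *)
  pose mu := (\sum_g c 0 (enum_rank g)) / #|G|%:R.
  apply/vlineP; exists mu; apply/rowP => k; rewrite !mxE mulr1.
  apply/eqP; rewrite -subr_eq0 -(enum_valK k); apply/eqP.
  apply: (@equilateral_independent v (fun g => c 0 (enum_rank g) - mu)) => //.
    rewrite sumrB sumr_const -mulr_natr /mu divfK ?subrr //.
    by rewrite pnatr_eq0 -lt0n.
  under eq_bigr do rewrite scalerBl.
  by rewrite sumrB c0 -scaler_sumr v0 scaler0 subrr.
have img_le : (limg phi <= <<codom v>>)%VS.
  apply/subvP => _ /memv_imgP[c _ ->]; rewrite phiE rpred_sum // => g _.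
  by rewrite rpredZ // memv_span // codom_f.
have := limg_ker_dim phi fullv; rewrite capfv dimvf /dim /= mul1n => <-.
rewrite leq_subLR leq_add ?(dimvS img_le) //.
by apply: leq_trans (dimvS ker_le) _; rewrite dim_vline leq_b1.
Qed.

Lemma rotdim_at_complete : gconnected G -> (#|G| - 1 <= rotdim_at s l)%N.
Proof.
move=> Gc; have [v vopt] : exists v, optimal s l v.
  by apply: exists_optimal => // ?; exact: ler01.
by have [w wopt <-] := rotdim_at_attained vopt; exact: optimal_span_dim.
Qed.

End Simplex.

(** * The maximum over all integer data *)

Lemma rotdim_conn_lt (R : realType) (G : sgraph) :
  gconnected G -> (rotdim_conn R G <= #|G| - 1)%N.
Proof.
move=> Gc; have [s [l <-]] := rotdim_conn_attained R G.
by apply: rotdim_at_lt.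
Qed.

Lemma rotdim_conn_not_complete (R : realType) (G : sgraph) :
  gconnected G -> ~ complete G -> (rotdim_conn R G <= #|G| - 2)%N.
Proof.
move=> Gc Gnc; have [s [l <-]] := rotdim_conn_attained R G.
by apply: rotdim_at_not_complete.
Qed.

Lemma rotdim_conn_complete (R : realType) (G : sgraph) : (0 < #|G|)%N ->
  gconnected G -> complete G -> rotdim_conn R G = (#|G| - 1)%N.
Proof.
move=> G0 Gc Gcomp; apply/eqP; rewrite eqn_leq rotdim_conn_lt //=.
apply: leq_trans (rotdim_conn_ge R (fun=> 1%N) (fun=> 1%N)).
exact: rotdim_at_complete.
Qed.

(** * Connected components and the equivalence *)

Lemma adj_connect_sym (G : sgraph) : connect_sym (@adj G).
Proof. exact/sym_connect_sym/adj_sym. Qed.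

(** A path of [G] that starts in a component stays in it, so it lifts to the induced graph edge by
    edge. *)
Lemma induced_component_connected (G : sgraph) (C : {set G}) :
  C \in gcomponents G -> gconnected (induced C).
Proof.
case/imsetP=> x _ CE.
apply/forallP => -[u uC]; apply/forallP => -[v vC].
have : connect (@adj G) u v.
  move: uC vC; rewrite CE !inE => xu xv.
  by apply: connect_trans xv; rewrite adj_connect_sym.
case/connectP=> p; elim: p u uC => [|w p IH] u uC /=.
  move=> _ vu; rewrite (_ : exist _ v vC = exist _ u uC) //; exact: val_inj.
case/andP=> uw wp vlast; have wC : w \in C.
  by move: uC; rewrite CE !inE => xu; apply: connect_trans xu (connect1 uw).
apply: connect_trans (IH w wC wp vlast); exact: connect1.
Qed.

Lemma card_component (G : sgraph) (C : {set G}) :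
  ~~ gconnected G -> C \in gcomponents G -> (0 < #|C| < #|G|)%N.
Proof.
move=> Gnc /imsetP[x _ ->]; apply/andP; split.
  by apply/card_gt0P; exists x; rewrite inE connect0.
rewrite -cardsT proper_card // finset.properEneq finset.subsetT andbT.
apply: contraNneq Gnc => /setP CT.
have xc y : connect (@adj G) x y by have := CT y; rewrite !inE.
apply/forallP => y; apply/forallP => z.
by apply: connect_trans (xc z); rewrite adj_connect_sym.
Qed.

Theorem theorem3p3 (R : realType) (G : sgraph) (n : nat)
    (n_gt0 : (0 < n)%N) (cardG : #|G| = n) :
  rotdim R G = (n - 1)%N <-> complete G.
Proof.
subst n; rewrite /rotdim; case: ifPn => Gc.
  split=> [rE|]; last exact: rotdim_conn_complete.
  apply: contrapT => Gnc; have := rotdim_conn_not_complete R Gc Gnc.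
  (* A graph that is not complete has two distinct vertices. Hence [n - 2 < n - 1], which truncated
     subtraction would falsify at [n = 1]. *)
  have [c cN] : exists p : G * G, p.1 != p.2.
    apply: contrapT => h; apply: Gnc => x y xy; case: h; by exists (x, y).
  have G2 : (1 < #|G|)%N.
    by apply/card_gt1P; exists c.1, c.2; split.
  by rewrite rE; case: #|G| G2 => [|[|k]] // _; rewrite subn1 !subSS subn0 ltnn.
split=> [rE|Gcomp]; last first.
  case/negP: Gc; apply/forallP => x; apply/forallP => y.
  by have [->|xy] := eqVneq x y; [exact: connect0|exact/connect1/Gcomp].
suff : (rotdim R G < #|G| - 1)%N by rewrite /rotdim (negPf Gc) rE ltnn.
rewrite /rotdim (negPf Gc).
have h (C : {set G}) : C \in gcomponents G ->
    (rotdim_conn R (induced C) < #|G| - 1)%N.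
  move=> CG; apply: leq_ltn_trans (rotdim_conn_lt R _) _.
    exact: induced_component_connected.
  rewrite card_sig; have /andP[C0 CG'] := card_component Gc CG.
  by apply: ltn_sub2r => //; apply: leq_ltn_trans CG'.
have [x _] := card_gt0P n_gt0.
(* The neutral element 0 of the maximum must satisfy the bound too; the component of [x] shows
   [0 < #|G| - 1]. *)
apply: (big_ind (fun k => (k < #|G| - 1)%N)) => // [|a b am bm].
  apply: leq_ltn_trans (h [set y | connect (@adj G) x y] _) => //.
  by apply/imsetP; exists x.
by rewrite gtn_max am.
Qed.
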